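(* Let $F$ be a graph with no isolated vertices, with girth $g$ and vertex feedback number $f$. If $g>f$ and $k\geq 3$, then $\mathrm{sat}_k(n,\text{Berge-}F)=O(n)$ as $n\to\infty$.
   Context: The girth of a graph is the length of its shortest cycle; the vertex feedback number is the least number of vertices whose deletion leaves an acyclic graph. A hypergraph $\mathcal{H}$ is a Berge-$F$ if $F$ and $\mathcal{H}$ can be embedded on a common vertex set with a bijection $\phi:E(F)\to E(\mathcal{H})$ such that $e\subseteq\phi(e)$ for all $e\in E(F)$; a hypergraph contains a Berge-$F$ if some subset of its edges forms a Berge-$F$. A $k$-uniform hypergraph $\mathcal{H}$ is Berge-$F$-saturated if it contains no Berge-$F$ but $\mathcal{H}+e$ contains a Berge-$F$ for every $k$-set $e\subseteq V(\mathcal{H})$ with $e\notin E(\mathcal{H})$. $\mathrm{sat}_k(n,\text{Berge-}F)$ is the minimum number of edges in a Berge-$F$-saturated $k$-uniform hypergraph on $n$ vertices. The paper assumes throughout that graphs have no isolated vertices (and have at least one edge). *)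

(* Defs.v *)
From mathcomp Require Import all_boot.
From mathcomp Require Import boolp.

Set Implicit Arguments.
Unset Strict Implicit.
Unset Printing Implicit Defensive.

(* A finite simple graph is a symmetric irreflexive relation [adj] on a        *)
(* finite type; a k-uniform hypergraph on V is a set of k-subsets of V.        *)

Definition no_isolated (T : finType) (adj : rel T) : Prop :=
  forall x, exists y, adj x y.

Definition edges (T : finType) (adj : rel T) : {set {set T}} :=
  [set [set p.1; p.2] | p : T * T & adj p.1 p.2].

(* The bound 2 < m excludes the closed walk x, y, x, which is a [ucycle].      *)
Definition has_cycle (T : finType) (adj : rel T) (m : nat) : bool :=
  (2 < m) && [exists c : m.-tuple T, ucycleb adj c].

Definition acyclic (T : finType) (adj : rel T) : Prop :=
  forall m, ~~ has_cycle adj m.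

(* [None] stands for infinity, the girth of an acyclic graph.                  *)
Definition girth (T : finType) (adj : rel T) : option nat :=
  if pselect (exists m, has_cycle adj m) is left cyc
  then Some (ex_minn cyc) else None.

Definition lt_girth (m : nat) (g : option nat) : bool :=
  if g is Some l then m < l else true.

Definition delete_vertices (T : finType) (adj : rel T) (S : {set T}) :
    rel {x : T | x \notin S} :=
  fun x y => adj (val x) (val y).
Arguments delete_vertices {T} adj S.

Definition feedback_number (T : finType) (adj : rel T) : nat :=
  #|[arg min_(S < [set: T] | `[< acyclic (delete_vertices adj S) >])
      #|S| ]|.

(* F and the hypergraph H are both embedded in a common vertex set W, via the  *)
(* injections i and j.                                                         *)
Definition is_Berge (T : finType) (adj : rel T) (V : finType)
    (H : {set {set V}}) : Prop :=
  exists (W : finType) (i : T -> W) (j : V -> W) (phi : {set T} -> {set V}),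
    [/\ injective i, injective j,
        {in edges adj &, injective phi},
        phi @: edges adj = H
      & forall a, a \in edges adj -> i @: a \subset j @: phi a].

Definition contains_Berge (T : finType) (adj : rel T) (V : finType)
    (H : {set {set V}}) : Prop :=
  exists2 H' : {set {set V}}, H' \subset H & is_Berge adj H'.

Definition uniform (k : nat) (V : finType) (H : {set {set V}}) : Prop :=
  forall h, h \in H -> #|h| = k.

Definition Berge_saturated (T : finType) (adj : rel T) (k : nat) (V : finType)
    (H : {set {set V}}) : Prop :=
  [/\ uniform k H, ~ contains_Berge adj H
    & forall h : {set V}, #|h| = k -> h \notin H ->
        contains_Berge adj (h |: H)].

(* [arg min] minimizes over the saturated H even though the default, the set   *)
(* of all subsets, need not be one of them; see [satP].                        *)
Definition sat (T : finType) (adj : rel T) (k n : nat) : nat :=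
  #|[arg min_(H < [set: {set 'I_n}] | `[< Berge_saturated adj k H >]) #|H| ]|.

Lemma girth_SomeP (T : finType) (adj : rel T) (g : nat) :
  girth adj = Some g <->
  has_cycle adj g /\ forall m, has_cycle adj m -> g <= m.
Proof.
rewrite /girth; case: pselect => [cyc|ncyc]; last first.
  by split=> // -[cg _]; case: ncyc; exists g.
case: ex_minnP => m cm minm; split=> [[<-] //|[cg ming]].
by congr Some; apply/eqP; rewrite eqn_leq minm ?ming.
Qed.

Lemma girth_NoneP (T : finType) (adj : rel T) :
  girth adj = None <-> acyclic adj.
Proof.
rewrite /girth; case: pselect => [cyc|ncyc].
  by split=> // ac; case: cyc => m cm; have := ac m; rewrite cm.
split=> // _ m; by apply/negP => cm; apply: ncyc; exists m.
Qed.

Lemma feedback_numberP (T : finType) (adj : rel T) :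
  (exists2 S : {set T}, acyclic (delete_vertices adj S)
                      & #|S| = feedback_number adj) /\
  forall S : {set T}, acyclic (delete_vertices adj S) ->
    feedback_number adj <= #|S|.
Proof.
rewrite /feedback_number; case: arg_minnP => [|S /asboolP acS minS].
  apply/asboolP => m; rewrite negb_and -implybE; apply/implyP => m_gt2.
  apply/existsP => -[c _].
  by have := valP (tnth c (Ordinal (ltnW (ltnW m_gt2)))); rewrite in_setT.
by split; [exists S | move=> S' /asboolP/minS].
Qed.

Lemma satP (T : finType) (adj : rel T) (k n : nat) :
  (exists x y, adj x y) ->
  (exists2 H : {set {set 'I_n}}, Berge_saturated adj k H
                               & #|H| = sat adj k n) /\
  forall H : {set {set 'I_n}}, Berge_saturated adj k H -> sat adj k n <= #|H|.
Proof.
move=> [x [y xy]].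
pose P (H : {set {set 'I_n}}) := `[< uniform k H /\ ~ contains_Berge adj H >].
have P0 : P set0.
  apply/asboolP; split=> [h|[H']]; first by rewrite inE.
  rewrite subset0 => /eqP-> [W [i [j [phi [_ _ _ e0 _]]]]].
  have : phi [set x; y] \in phi @: edges adj.
    by apply: imset_f; apply/imsetP; exists (x, y); rewrite ?inE.
  by rewrite e0 inE.
have [H satH] : exists H : {set {set 'I_n}}, Berge_saturated adj k H.
  case: (arg_maxnP (fun H : {set {set 'I_n}} => #|H|) P0).
  move=> H /asboolP[uH fH] maxH; exists H; split=> // h hk hH.
  apply: contrapT => fhH.
  suff /maxH : P (h |: H) by rewrite /= cardsU1 hH add1n ltnn.
  by apply/asboolP; split=> // h'; rewrite in_setU1 => /predU1P[->|/uH].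
rewrite /sat /arg_min /extremum.
case: pickP => [H' /andP[/asboolP satH' /forallP minH']|none].
  by split; [exists H' | move=> H'' /asboolP; exact: (implyP (minH' H''))].
have Q : `[< Berge_saturated adj k H >] by apply/asboolP.
pose M := [arg min_(H' < H | `[< Berge_saturated adj k H' >]) #|H'| ].
have := none M; rewrite /M; case: arg_minnP => // M' QM' minM' /negP[].
by rewrite /= QM'; apply/forallP => H'; apply/implyP/minM'.
Qed.

(* Main.v *)
(* Let S be a minimum feedback vertex set of F, with f elements. Outside a      *)
(* bounded set of vertices, cut the vertex set into (k-1)-blocks; take f        *)
(* special vertices a_s (the hubs) and all hyperedges {a_s} u block, together   *)
(* with one hyperedge joining a_s to a_t by private vertices for every edge st  *)
(* of F[S]. A Berge cycle that avoids f-1 of the hubs stays in one block and    *)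
(* the remaining hub, so it has at most f < g hyperedges; since deleting f-1    *)
(* vertices of F leaves a cycle, this skeleton contains no Berge-F. Let H be a  *)
(* maximal Berge-F-free extension of it. If H had more than C n hyperedges,     *)
(* some of them would form a subhypergraph of large minimum degree outside the  *)
(* bounded set; the forest F - S embeds there greedily, with its vertices in    *)
(* distinct blocks, and the skeleton joins these vertices to the hubs, which    *)
(* gives a Berge-F in H.                                                        *)

Require Import Defs.
From mathcomp Require Import all_boot boolp.

Set Implicit Arguments.
Unset Strict Implicit.
Unset Printing Implicit Defensive.

(** It is enough to exhibit, for each large n, one saturated hypergraph with O(n) hyperedges.
    [Berge_saturated_extension] completes the skeleton to one, so all depends on two opposing
    properties of the skeleton. It contains no Berge-F: by [skeleton_free], a Berge-F in it would
    yield a cycle of F of length at most f, against g > f. It is nearly a Berge-F: all that is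
    missing is a Berge copy of the forest F - S with its vertices in distinct blocks. By
    [dense_core] and [forest_embedding], more than a fixed multiple of n + 1 hyperedges force such a
    copy, and [card_skeleton_extension] assembles the Berge-F. [interval_frame] realises hubs,
    gadgets and blocks on n vertices with boundedly many junk vertices, which keeps the multiple
    independent of n. *)

(** * Cycles, feedback sets and leaves of forests *)

Lemma has_cycle_ucycle (T : finType) (adj : rel T) (c : seq T) :
  2 < size c -> ucycle adj c -> has_cycle adj (size c).
Proof.
by move=> c_gt2 uc; rewrite /has_cycle c_gt2; apply/existsP; exists (in_tuple c).
Qed.

Lemma has_cycleP (T : finType) (adj : rel T) (m : nat) :
  has_cycle adj m ->
  exists c : seq T, [/\ 2 < size c, size c = m & ucycle adj c].
Proof.
move=> /andP[m_gt2 /existsP[c uc]]; exists c.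
by split; rewrite // size_tuple.
Qed.

Lemma ucycle_delete_vertices (T : finType) (adj : rel T) (S : {set T})
    (c : seq {x : T | x \notin S}) :
  ucycle adj (map val c) = ucycle (delete_vertices adj S) c.
Proof. by rewrite /ucycle cycle_map (map_inj_uniq val_inj). Qed.

(** Lets cycles of F - S be handled as sequences over [T] that avoid [S], without the subtype. *)
Lemma acyclic_delete_vertices (T : finType) (adj : rel T) (S : {set T}) :
  acyclic (delete_vertices adj S) <->
  forall c : seq T, 2 < size c -> ucycle adj c -> ~~ all [predC S] c.
Proof.
split=> [acS c c_gt2 uc|acS m].
  apply/negP => /allP cS.
  have def_c : map val (pmap (insub : T -> option {x : T | x \notin S}) c) = c.
    by rewrite (pmap_filter (insubK _)); apply/all_filterP/allP => x /cS xS;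
       rewrite insubT.
  have := acS (size c); rewrite -[in size c]def_c size_map.
  apply/negP/negPn/has_cycle_ucycle; first by rewrite -(size_map val) def_c.
  by rewrite -ucycle_delete_vertices def_c.
apply/negP => /has_cycleP[c [c_gt2 _]]; rewrite -ucycle_delete_vertices => uc.
have := acS (map val c) _ uc; rewrite size_map => /(_ c_gt2)/negP[].
by apply/allP => _ /mapP[x _ ->]; exact: valP x.
Qed.

(* The head of a longest path in X either has its successor on the path as     *)
(* only neighbour, or closes a cycle.                                          *)
Lemma acyclic_leaf (T : finType) (adj : rel T) (X : {set T}) :
  symmetric adj -> irreflexive adj ->
  (forall c : seq T, 2 < size c -> ucycle adj c -> ~~ all [in X] c) ->
  X != set0 ->
  exists2 x, x \in X & exists y, forall z, z \in X -> adj x z -> z = y.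
Proof.
move=> adj_sym adj_irr noc /set0Pn[x0 x0X].
pose P n := [exists c : n.+1.-tuple T,
  [&& uniq c, all [in X] c & sorted adj c]].
have P0 : exists n, P n.
  by exists 0; apply/existsP; exists [tuple x0]; rewrite /= x0X.
have Pmax n : P n -> n <= #|T|.
  move=> /existsP[c /and3P[uc _ _]].
  by apply: ltnW; rewrite -[n.+1](size_tuple c) -(card_uniqP uc) max_card.
case: (ex_maxnP P0 Pmax) => n /existsP[[[//|x p] sz] /= /and3P[uc cX pc]] maxn.
have [xX pX] := andP cX; exists x => //; exists (head x p) => z zX xz.
apply/eqP/negPn/negP => zp.
have zx : z != x by apply: contraTneq xz => ->; rewrite adj_irr.
have [zin|znin] := boolP (z \in x :: p); last first.
  have /maxn : P n.+1; last by rewrite ltnn.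
  apply/existsP; have sz' : size [:: z, x & p] == n.+2 by rewrite -(eqP sz).
  by exists (Tuple sz') => /=; rewrite znin uc zX cX /= adj_sym xz pc.
move: zin; rewrite inE (negPf zx) /= => /splitPr def_p.
case: def_p uc cX pc zp {pX sz} => p1 p2 uc cX pc zp.
(* The segment from [x] to [z] has at least three vertices, as [z] is not the successor of [x]; the
   edge [xz] closes it to a cycle. *)
case: p1 uc cX pc zp => [|y p1] uc cX pc zp; first by rewrite eqxx in zp.
suff /(@noc [:: x, y & rcons p1 z])/negP[] : ucycle adj [:: x, y & rcons p1 z].
- by rewrite /= size_rcons.
- by move: cX; rewrite -cat_rcons all_cat => /and3P[/= -> ? _].
move: pc; rewrite -cat_rcons cat_path rcons_cons => /andP[pc _].
apply/andP; split; first by rewrite /cycle rcons_path pc /= last_rcons adj_sym.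
move: uc; rewrite -[_ && _]/(uniq (x :: _)) -cat_rcons -cat_cons cat_uniq.
by case/andP.
Qed.

(** * Edges and Berge copies *)

Lemma mem_edges (T : finType) (adj : rel T) (x y : T) :
  adj x y -> [set x; y] \in edges adj.
Proof. by move=> xy; apply/imsetP; exists (x, y); rewrite ?inE. Qed.

Lemma edgesP (T : finType) (adj : rel T) (e : {set T}) :
  e \in edges adj -> exists x y, adj x y /\ e = [set x; y].
Proof. by move=> /imsetP[[x y]]; rewrite inE => xy ->; exists x, y. Qed.

(** Every vertex of F lies on an edge, so its image lies in a hyperedge and hence in the image of
    [V]: the ambient set [W] can be replaced by [V]. *)
Lemma is_Berge_within (T : finType) (adj : rel T) (V : finType)
    (H : {set {set V}}) :
  no_isolated adj -> is_Berge adj H ->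
  exists (i : T -> V) (phi : {set T} -> {set V}),
    [/\ injective i, {in edges adj &, injective phi},
        forall e, e \in edges adj -> phi e \in H
      & forall e x, e \in edges adj -> x \in e -> i x \in phi e].
Proof.
move=> iso [W [i [j [phi [inj_i inj_j inj_phi defH sub_phi]]]]].
have /choice[i' def_i'] x : exists v, i x = j v.
  have [y xy] := iso x; have /subsetP/(_ (i x)) := sub_phi _ (mem_edges xy).
  by rewrite imset_f ?set21// => /(_ isT)/imsetP[v _ ->]; exists v.
exists i', phi; split=> //.
- by move=> x y xy; apply: inj_i; rewrite !def_i' xy.
- by move=> e eE; rewrite -defH imset_f.
move=> e x eE xe; have /subsetP/(_ (i x)) := sub_phi _ eE.
by rewrite imset_f // => /(_ isT)/imsetP[v ve]; rewrite def_i' => /inj_j->.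
Qed.

(* Fails for [size c = 2], the only case in which [next c (next c x) = x].      *)
Lemma next_edge_inj (T : finType) (c : seq T) :
  2 < size c -> uniq c -> {in c &, injective (fun x => [set x; next c x])}.
Proof.
move=> c_gt2 uc x y xc yc eq_e; apply/eqP/negPn/negP => nxy.
have nn z : z \in c -> next c (next c z) != z.
  move=> /rot_to[i p def_p].
  have : uniq (z :: p) by rewrite -def_p rot_uniq.
  have : 2 < size (z :: p) by rewrite -def_p size_rot.
  rewrite -!(next_rot i uc) def_p.
  case: p {def_p} => [//|a [//|b p]] _ /=; rewrite !inE !negb_or !eqxx.
  by case/andP => /and3P[za zb _] _; rewrite [a == z]eq_sym (negPf za) eq_sym.
have : x \in [set y; next c y] by rewrite -eq_e set21.
rewrite !inE (negPf nxy) => /= /eqP xy.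
have : y \in [set x; next c x] by rewrite eq_e set21.
rewrite !inE eq_sym (negPf nxy) => /= /eqP yx.
by have /eqP := nn _ xc; rewrite -yx -xy.
Qed.

(** * The skeleton and its freeness *)

(* The blocks partition the complement of [junk]. [gadget e] pads [hub @: e] to *)
(* a hyperedge joining two hubs, with vertices that lie in no other hyperedge   *)
(* of the skeleton.                                                             *)
Record frame (T V : finType) (k : nat) := Frame {
  hub : T -> V;
  gadget : {set T} -> {set V};
  block : V -> {set V};
  junk : {set V};
  hub_inj : injective hub;
  hub_junk : forall x, hub x \in junk;
  gadget_junk : forall e, gadget e \subset junk;
  hub_gadget : forall x e, hub x \notin gadget e;
  gadget_inj : forall e1 e2 v, v \in gadget e1 -> v \in gadget e2 -> e1 = e2;
  card_gadget : forall e, #|gadget e| = k.-2;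
  block_refl : forall v, v \notin junk -> v \in block v;
  block_eq : forall u v, v \notin junk -> u \in block v ->
    u \notin junk /\ block u = block v;
  card_block : forall v, v \notin junk -> #|block v| = k.-1 }.

(** Realises an edge of F from [s] to a vertex placed anywhere in the block of [v]. *)
Definition spoke (T V : finType) (k : nat) (fr : frame T V k) (s : T) (v : V) :
  {set V} := hub fr s |: block fr v.

Definition brace (T V : finType) (k : nat) (fr : frame T V k) (e : {set T}) :
  {set V} := hub fr @: e :|: gadget fr e.

Definition skeleton (T : finType) (adj : rel T) (V : finType) (k : nat)
    (fr : frame T V k) (S : {set T}) : {set {set V}} :=
  [set spoke fr s v | s in S, v in ~: junk fr] :|:
  [set brace fr e | e in edges adj & e \subset S].

Lemma block_junk (T V : finType) (k : nat) (fr : frame T V k) (u v : V) :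
  v \notin junk fr -> u \in junk fr -> u \notin block fr v.
Proof.
by move=> vD uD; apply/negP => /(block_eq vD)[]; rewrite uD.
Qed.

Lemma skeletonP (T : finType) (adj : rel T) (V : finType) (k : nat)
    (fr : frame T V k) (S : {set T}) (h : {set V}) :
  h \in skeleton adj fr S ->
  (exists s v, [/\ s \in S, v \notin junk fr & h = spoke fr s v]) \/
  (exists2 e, e \in edges adj /\ e \subset S & h = brace fr e).
Proof.
rewrite inE => /orP[/imset2P[s v sS]|/imsetP[e]].
  by rewrite inE => vD ->; left; exists s, v.
by rewrite inE => /andP[eE eS] ->; right; exists e.
Qed.

Lemma spoke_skeleton (T : finType) (adj : rel T) (V : finType) (k : nat)
    (fr : frame T V k) (S : {set T}) (s : T) (v : V) :
  s \in S -> v \notin junk fr -> spoke fr s v \in skeleton adj fr S.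
Proof.
by move=> sS vD; rewrite inE; apply/orP; left; apply: imset2_f; rewrite ?inE.
Qed.

Lemma brace_skeleton (T : finType) (adj : rel T) (V : finType) (k : nat)
    (fr : frame T V k) (S : {set T}) (e : {set T}) :
  e \in edges adj -> e \subset S -> brace fr e \in skeleton adj fr S.
Proof.
by move=> eE eS; rewrite inE; apply/orP; right; apply: imset_f; rewrite inE eE.
Qed.

Lemma uniform_skeleton (T : finType) (adj : rel T) (V : finType) (k : nat)
    (fr : frame T V k) (S : {set T}) :
  irreflexive adj -> 1 < k -> uniform k (skeleton adj fr S).
Proof.
move=> adj_irr k_gt1 h /skeletonP[[s [v [sS vD ->]]]|[e [eE _] ->]].
  rewrite cardsU1 block_junk ?hub_junk // card_block // add1n prednK //.
  exact: ltnW.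
have -> : #|brace fr e| = #|hub fr @: e| + #|gadget fr e|.
  apply/eqP; rewrite (leq_card_setU (hub fr @: e) _).2 -setI_eq0.
  apply/eqP/setP => v; rewrite !inE; apply/negP => /andP[/imsetP[x _ ->]].
  by rewrite (negPf (hub_gadget _ _ _)).
rewrite card_imset ?card_gadget; last exact: hub_inj.
have [x [y [xy ->]]] := edgesP eE.
rewrite cards2 (contraTneq _ xy) => [|->]; last by rewrite adj_irr.
by rewrite addnC addn2; case: k k_gt1 fr => [//|[//|k']].
Qed.

(* A Berge-F in the skeleton has at most #|S| - 1 core vertices among the hubs *)
(* other than hub s0, so some cycle of F avoids them. No gadget vertex lies on *)
(* that cycle, since it has degree 1, so the cycle can only leave a block      *)
(* through hub s0. Hence it stays in a single block and uses at most #|S|      *)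
(* hyperedges, fewer than the girth.                                           *)
Lemma skeleton_free (T : finType) (adj : rel T) (V : finType) (k : nat)
    (fr : frame T V k) (S : {set T}) :
  irreflexive adj -> (exists x y, adj x y) -> no_isolated adj ->
  (forall R : {set T}, #|R| < #|S| -> ~ acyclic (delete_vertices adj R)) ->
  (forall m, has_cycle adj m -> #|S| < m) ->
  ~ contains_Berge adj (skeleton adj fr S).
Proof.
move=> adj_irr [x0 [y0 xy0]] iso minS long [H' subH /(is_Berge_within iso)].
move=> [i [phi [inj_i inj_phi phiH i_phi]]].
have {}phiH e : e \in edges adj -> phi e \in skeleton adj fr S.
  by move=> /phiH; apply/subsetP.
(* F has an edge, and its hyperedge in the skeleton, spoke or brace, involves an element of [S]. *)
have [s0 s0S] : exists s, s \in S.
  have /skeletonP[[s [_ [sS _ _]]]|[e [eE /subsetP eS] _]] :=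
    phiH _ (mem_edges xy0); first by exists s.
  by have [x [y [_ def_e]]] := edgesP eE; exists x; rewrite eS // def_e set21.
pose R := [set x | i x \in hub fr @: (S :\ s0)].
have ltRS : #|R| < #|S|.
  rewrite (cardsD1 s0 S) s0S add1n ltnS -(card_imset R inj_i).
  rewrite -(card_imset (S :\ s0) (hub_inj (f := fr))) subset_leq_card //.
  by apply/subsetP => _ /imsetP[x xR ->]; rewrite inE in xR.
have [c [c_gt2 uc_c /allP cR]] :
    exists c : seq T, [/\ 2 < size c, ucycle adj c & all [predC R] c].
  apply: contrapT => noc; apply: (minS _ ltRS); apply/acyclic_delete_vertices.
  by move=> c c_gt2 uc_c; apply/negP => cR; apply: noc; exists c.
have [cyc uc] := andP uc_c.
pose E x := [set x; next c x].
have Eadj x : x \in c -> E x \in edges adj.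
  by move=> xc; apply/mem_edges/next_cycle.
have iE x : x \in c -> i x \in phi (E x).
  by move=> xc; apply: i_phi; rewrite ?Eadj ?set21.
have iEn x : x \in c -> i (next c x) \in phi (E x).
  by move=> xc; apply: i_phi; rewrite ?Eadj ?set22.
have inhub x s : x \in c -> s \in S -> i x = hub fr s -> s = s0.
  move=> /cR xR sS xs; apply/eqP/negPn/negP => ss0; case/negP: xR.
  by rewrite /R inE xs; apply: imset_f; rewrite in_setD1 ss0.
(* A gadget vertex lies in only one hyperedge of the skeleton, whereas a vertex of the cycle lies in
   the distinct hyperedges of its two cycle edges. *)
have ingadget x e : x \in c -> i x \notin gadget fr e.
  move=> xc; apply/negP => xe; have pc : prev c x \in c by rewrite mem_prev.
  have only h : h \in skeleton adj fr S -> i x \in h -> h = brace fr e.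
    have xD := subsetP (gadget_junk fr e) _ xe.
    case/skeletonP => [[s [v [sS vD ->]]]|[e' _ ->]].
      rewrite !inE (negPf (block_junk vD xD)) orbF => /eqP xs.
      by have := hub_gadget fr s e; rewrite -xs xe.
    rewrite !inE => /orP[/imsetP[s _ xs]|xe'].
      by have := hub_gadget fr s e; rewrite -xs xe.
    by rewrite (gadget_inj xe xe').
  have eqE : phi (E x) = phi (E (prev c x)).
    have inpE : i x \in phi (E (prev c x)).
      by rewrite -{1}(next_prev uc x); apply: iEn.
    by rewrite (only _ (phiH _ (Eadj _ xc)) (iE _ xc))
               (only _ (phiH _ (Eadj _ pc)) inpE).
  have /(next_edge_inj c_gt2 uc xc pc) px : E x = E (prev c x).
    by apply: inj_phi eqE; apply: Eadj.
  by have := prev_cycle cyc xc; rewrite -px adj_irr.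
(* In a brace, the only place left for a vertex of the cycle is [hub fr s0], which cannot hold both
   ends of an edge. *)
have spokeE x : x \in c ->
    exists s v, [/\ s \in S, v \notin junk fr & phi (E x) = spoke fr s v].
  move=> xc; have nc : next c x \in c by rewrite mem_next.
  have /skeletonP[//|[e [_ eS] def_h]] := phiH _ (Eadj _ xc).
  have to_hub z : z \in c -> i z \in phi (E x) -> i z = hub fr s0.
    move=> zc; rewrite def_h inE (negPf (ingadget _ _ zc)) orbF.
    by case/imsetP => s se zs; rewrite -(inhub _ _ zc _ zs) ?(subsetP eS).
  have : i x = i (next c x) by rewrite (to_hub _ xc (iE _ xc)) (to_hub _ nc (iEn _ xc)).
  by move=> /inj_i xn; have := next_cycle cyc xc; rewrite -xn adj_irr.
(* At most one vertex of the cycle sits on [hub fr s0]; if there is none, any vertex serves as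
   [y]. *)
have [y yc yP] : exists2 y, y \in c &
    forall z, z \in c -> z != y -> i z <> hub fr s0.
  have [[y [yc ys0]]|noy] := pselect (exists y, y \in c /\ i y = hub fr s0).
    exists y => // z zc /eqP zy zs0; apply: zy; apply: inj_i.
    by rewrite zs0 ys0.
  case: c c_gt2 noy {uc_c cR cyc uc E Eadj iE iEn inhub ingadget spokeE} => //.
  move=> y c _ noy; exists y; rewrite ?mem_head // => z zc _ zs0.
  by apply: noy; exists z.
have inblock x z s v : x \in c -> s \in S -> phi (E x) = spoke fr s v ->
    z \in c -> z != y -> i z \in phi (E x) -> i z \in block fr v.
  move=> xc sS -> zc zy; rewrite !inE => /orP[/eqP zs|//].
  by case: (yP _ zc zy); rewrite zs (inhub _ _ zc sS zs).
have step x : x \in c -> x != y -> next c x != y ->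
    block fr (i (next c x)) = block fr (i x).
  move=> xc xy ny; have [s [v [sS vD def_h]]] := spokeE _ xc.
  have nc : next c x \in c by rewrite mem_next.
  have [_ ->] := block_eq vD (inblock _ _ _ _ xc sS def_h nc ny (iEn _ xc)).
  by have [_ ->] := block_eq vD (inblock _ _ _ _ xc sS def_h xc xy (iE _ xc)).
(* Rotated to start at [y], the rest of the cycle is a path along which [step] keeps the block
   constant. *)
have [B defB] : exists B, forall z, z \in c -> z != y -> block fr (i z) = B.
  have [j p def_p] := rot_to yc.
  have up : uniq (y :: p) by rewrite -def_p rot_uniq.
  have mem_p : y :: p =i c by move=> z; rewrite -def_p mem_rot.
  have next_p z : next (y :: p) z = next c z by rewrite -def_p next_rot.
  exists (block fr (i (head y p))) => z; rewrite -mem_p inE => + zy.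
  rewrite (negPf zy) /= => zp.
  have : fpath (next c) y p.
    by have := cycle_next up; rewrite (eq_fcycle next_p) /= rcons_path => /andP[].
  case: p zp {def_p next_p} up mem_p => [//|a p] zp /= /andP[yp _] mem_p.
  case/andP=> _; have a_ok : a \in c /\ a != y.
    by rewrite -mem_p !inE eqxx orbT; split=> //; apply: contraNneq yp => <-;
       rewrite mem_head.
  have p_ok b : b \in p -> b \in c /\ b != y.
    move=> bp; rewrite -mem_p !inE bp !orbT; split=> //.
    by apply: contraNneq yp => <-; rewrite inE bp orbT.
  elim: p a {yp mem_p} a_ok p_ok zp => [|b p IHp] a [ac ay] p_ok /=.
    by rewrite inE => /eqP->.
  rewrite inE => /orP[/eqP->//|zp] /andP[/eqP nab pp].
  have [bc yb] := p_ok b (mem_head _ _).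
  rewrite (IHp b) //; last by move=> d dp; apply: p_ok; rewrite inE dp orbT.
  by rewrite -nab step // nab.
(* Each edge of the cycle has an end other than [y], and this end fixes the block of its spoke; only
   the hub can vary. *)
have imE : [set phi (E x) | x in c] \subset [set hub fr s |: B | s in S].
  apply/subsetP => _ /imsetP[x xc ->].
  have [s [v [sS vD def_h]]] := spokeE _ xc.
  have nc : next c x \in c by rewrite mem_next.
  suff <- : block fr v = B by rewrite def_h; apply: imset_f.
  have [xy|xy] := eqVneq x y; last first.
    have xv := inblock _ _ _ _ xc sS def_h xc xy (iE _ xc).
    by rewrite -(defB x) // (block_eq vD xv).2.
  have ny : next c x != y.
    by rewrite -xy; apply: contraTneq (next_cycle cyc xc) => ->; rewrite adj_irr.
  have nv := inblock _ _ _ _ xc sS def_h nc ny (iEn _ xc).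
  by rewrite -(defB (next c x)) // (block_eq vD nv).2.
have := long _ (has_cycle_ucycle c_gt2 uc_c).
rewrite ltnNge => /negP[]; rewrite -(card_uniqP uc).
rewrite -(card_in_imset (D := mem c) (f := phi \o E)); last first.
  move=> x z xc zc /= eqE; apply: (next_edge_inj c_gt2 uc xc zc).
  by apply: inj_phi eqE; apply: Eadj.
exact: leq_trans (subset_leq_card imE) (leq_imset_card _ _).
Qed.

(** * Dense subhypergraphs and greedy embedding of forests *)

(** From large average to large minimum degree: in a smallest [E] with more than
    [c * #|cover E :\: D| + c] hyperedges, removing a vertex of degree at most [c] with its
    hyperedges would keep the inequality. The extra [c] prevents [E] from living inside [D], which
    has at most [c] subsets. *)
Lemma dense_core (V : finType) (D : {set V}) (H : {set {set V}}) (c : nat) :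
  2 ^ #|D| <= c -> c * #|V| + c < #|H| ->
  exists E : {set {set V}},
    [/\ E \subset H, cover E :\: D != set0
      & forall v, v \in cover E :\: D -> c < #|[set e in E | v \in e]|].
Proof.
move=> D_le H_gt.
pose P (E : {set {set V}}) := (E \subset H) && (c * #|cover E :\: D| + c < #|E|).
have PH : P H.
  rewrite /P subxx; apply: leq_ltn_trans H_gt.
  by rewrite leq_add2r leq_mul2l max_card orbT.
have [E /andP[EH E_gt] minE] := arg_minnP (fun E : {set {set V}} => #|E|) PH.
exists E; split=> // [|v vU].
  apply/eqP => U0; move: E_gt; rewrite U0 cards0 muln0 add0n ltnNge => /negP[].
  apply: leq_trans D_le; rewrite -card_powerset subset_leq_card //.
  apply/subsetP => e eE; rewrite inE; apply: subset_trans (bigcup_sup e eE) _.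
  by rewrite -setD_eq0 -/(cover E) U0.
rewrite ltnNge; apply/negP => deg_le.
pose E1 := [set e in E | v \notin e].
have card_E : #|E| = #|[set e in E | v \in e]| + #|E1|.
  rewrite -(cardsID [set e : {set V} | v \in e] E); congr (_ + _).
    by apply: eq_card => e; rewrite !inE.
  by apply: eq_card => e; rewrite !inE andbC.
have sE1 : E1 \subset E by apply/subsetP => e; rewrite inE => /andP[].
have U1 : cover E1 :\: D \subset (cover E :\: D) :\ v.
  apply/subsetP => u; rewrite !inE => /andP[-> /bigcupP[e]].
  rewrite inE => /andP[eE ve] ue; apply/andP; split.
    by apply: contraNneq ve => <-.
  by apply/bigcupP; exists e.
have : P E1.
  rewrite /P (subset_trans sE1 EH) /=.
  have := subset_leq_card U1; rewrite [#|cover E :\: D|](cardsD1 v) vU in E_gt *.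
  set u1 := #|cover E1 :\: D|; set u := #|_ :\ v| in E_gt * => le_u1.
  have : c * u1 <= c * u by rewrite leq_mul2l le_u1 orbT.
  move: E_gt; rewrite card_E mulnDr muln1 => E_gt le_cu.
  rewrite -(ltn_add2l c); apply: leq_trans (leq_trans E_gt _).
    by rewrite ltnS addnA leq_add2r leq_add2l.
  by rewrite leq_add2r.
move/minE; rewrite leqNgt card_E -{1}[#|E1|]add0n ltn_add2r card_gt0 => /negP[].
have [e eE ve] := bigcupP (setDP vU).1.
by apply/set0Pn; exists e; rewrite inE eE.
Qed.

(** Bounds the region that a partial embedding must avoid, independently of the number of blocks. *)
Lemma card_cover_blocks (T V : finType) (k : nat) (fr : frame T V k)
    (X : {set T}) (p : T -> V) :
  (forall x, x \in X -> p x \notin junk fr) ->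
  #|junk fr :|: \bigcup_(x in X) block fr (p x)| <= #|junk fr| + #|T| * k.-1.
Proof.
move=> pX; apply: leq_trans (leq_card_setU _ _) _; rewrite leq_add2l.
apply: leq_trans (_ : \sum_(x in X) #|block fr (p x)| <= _).
  elim/big_rec2: _ => [|x n B _ IH]; first by rewrite cards0.
  by apply: leq_trans (leq_card_setU _ _) _; rewrite leq_add2l.
apply: leq_trans (_ : \sum_(x in X) k.-1 <= _).
  by apply: leq_sum => x /pX xD; rewrite card_block.
by rewrite sum_nat_const leq_mul2r max_card orbT.
Qed.

(** Strip a leaf and embed the rest. Among the hyperedges through the image of the leaf's neighbour,
    few lie inside the junk and the used blocks, and at most [2 ^ #|T|] are already assigned. Any
    other one represents the new edge and offers a vertex in a fresh block. *)
Lemma forest_embedding (T : finType) (adj : rel T) (V : finType) (k : nat)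
    (fr : frame T V k) (S : {set T}) (E : {set {set V}}) :
  symmetric adj -> irreflexive adj -> acyclic (delete_vertices adj S) ->
  cover E :\: junk fr != set0 ->
  (forall v, v \in cover E :\: junk fr ->
    2 ^ (#|junk fr| + #|T| * k.-1) + 2 ^ #|T| < #|[set e in E | v \in e]|) ->
  exists (p : T -> V) (psi : {set T} -> {set V}),
    [/\ forall x, x \notin S -> p x \notin junk fr,
        forall x y, x \notin S -> y \notin S -> p x \in block fr (p y) -> x = y,
        {in [set e in edges adj | [disjoint e & S]] &, injective psi},
        forall e, e \in edges adj -> [disjoint e & S] -> psi e \in E
      & forall e x, e \in edges adj -> [disjoint e & S] -> x \in e ->
          p x \in psi e].
Proof.
move=> adj_sym adj_irr acS U0 deg.
set U := cover E :\: junk fr in U0 deg.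
have [u0 u0U] := set0Pn _ U0.
suff emb n (X : {set T}) : #|X| = n -> [disjoint X & S] ->
  exists (p : T -> V) (psi : {set T} -> {set V}),
    [/\ forall x, x \in X -> p x \in U,
        forall x y, x \in X -> y \in X -> p x \in block fr (p y) -> x = y,
        {in [set e in edges adj | e \subset X] &, injective psi},
        forall e, e \in edges adj -> e \subset X -> psi e \in E
      & forall e x, e \in edges adj -> e \subset X -> x \in e -> p x \in psi e].
  have [|p [psi [pU p_inj psi_inj psiE p_psi]]] := emb _ (~: S) erefl.
    by rewrite disjoints_subset.
  exists p, psi; split=> [x xS|x y xS yS|e1 e2|e eE|e x eE].
  - by have := pU x; rewrite !inE xS => /(_ isT)/andP[].
  - by apply: p_inj; rewrite inE.
  - rewrite !inE !disjoints_subset => e1E e2E.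
    by apply: psi_inj; rewrite !inE.
  - by rewrite disjoints_subset; apply: psiE.
  - by rewrite disjoints_subset; apply: p_psi.
elim: n X => [|n IHn] X cX XS.
  have X0 : X = set0 by apply/eqP; rewrite -cards_eq0 cX.
  have noE e : e \in edges adj -> e \subset X -> False.
    by move=> /edgesP[x [y [_ ->]]] /subsetP/(_ x (set21 _ _)); rewrite X0 inE.
  exists (fun=> u0), (fun=> set0); split=> [x|x y|e1 e2|e|e x].
  - by rewrite X0 inE.
  - by rewrite X0 inE.
  - by rewrite !inE => /andP[e1E /(noE _ e1E)].
  - by move=> eE /(noE _ eE).
  - by move=> eE /(noE _ eE).
have [x xX [y xy]] : exists2 x, x \in X &
    exists y, forall z, z \in X -> adj x z -> z = y.
  apply: acyclic_leaf => // [c c_gt2 uc|]; last by rewrite -card_gt0 cX.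
  apply: contra (proj1 (acyclic_delete_vertices _ _) acS c c_gt2 uc).
  by move/allP=> cX'; apply/allP => z /cX' zX; rewrite inE (disjointFr XS).
pose X' := X :\ x.
have sX' : X' \subset X by apply: subD1set.
have [||p [psi [pU p_inj psi_inj psiE p_psi]]] := IHn X'.
- by apply/eqP; rewrite -eqSS -cX (cardsD1 x X) xX.
- by apply: disjointWl XS.
pose J := junk fr :|: \bigcup_(z in X') block fr (p z).
have [u [e0 [uU uJ e0P]]] : exists u e0, [/\ u \in U, u \notin J &
    forall z, z \in X' -> adj x z ->
      [/\ e0 \in E, forall e, psi e != e0, p z \in e0 & u \in e0]].
  have [X'0|[z1 z1X]] := set_0Vmem X'.
    (* With nothing placed yet there is no edge to represent, and [set0] is a placeholder. *)
    exists u0, set0; split=> // [|z]; last by rewrite X'0 inE.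
    by rewrite /J X'0 big_set0 setU0; have [] := setDP u0U.
  (* If [y] is not in [X'], the vertex [x] has no neighbour there; only a fresh block is wanted, and
     any placed vertex has enough degree to give one. *)
  pose w := if y \in X' then y else z1.
  have wX : w \in X' by rewrite /w; case: ifP.
  have cardJ : #|J| <= #|junk fr| + #|T| * k.-1.
    by apply: card_cover_blocks => z /pU; rewrite inE => /andP[].
  pose bad := powerset J :|: [set psi e | e in [set: {set T}]].
  have card_bad : #|bad| <= 2 ^ (#|junk fr| + #|T| * k.-1) + 2 ^ #|T|.
    apply: leq_trans (leq_card_setU _ _) (leq_add _ _).
      by rewrite card_powerset leq_exp2l.
    apply: leq_trans (leq_imset_card _ _) _.
    by rewrite -powersetT card_powerset cardsT.
  have /subsetPn[e0] : ~~ ([set e in E | p w \in e] \subset bad).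
    apply/negP => /subset_leq_card; rewrite leqNgt => /negP[].
    by apply: leq_ltn_trans card_bad (deg _ (pU _ wX)).
  rewrite !inE negb_or => /andP[e0E we0] /andP[/subsetPn[u ue0 uJ] e0psi].
  exists u, e0; split=> // [|z zX' xz].
    rewrite !inE; move: uJ; rewrite inE negb_or => /andP[-> _] /=.
    by apply/bigcupP; exists e0.
  split=> // [e|]; first by apply: contraNneq e0psi => <-; rewrite imset_f ?inE.
  by move: we0; rewrite /w -(xy z) ?zX' // (subsetP sX').
have [uD ub] : u \notin junk fr /\ forall z, z \in X' -> u \notin block fr (p z).
  move: uJ; rewrite inE negb_or => /andP[uD /bigcupP ub]; split=> // z zX'.
  by apply/negP => uz; apply: ub; exists z.
have X'P z : z \in X -> z != x -> z \in X' by rewrite !inE => -> ->.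
have edge_x e : e \in edges adj -> e \subset X -> x \in e ->
    exists2 z, z \in X' /\ adj x z & e = [set x; z].
  move=> eE /subsetP eX xe; have [a [b [ab def_e]]] := edgesP eE.
  have nab : a != b by apply: contraTneq ab => ->; rewrite adj_irr.
  move: xe; rewrite def_e !inE => /orP[/eqP xa|/eqP xb]; [exists b|exists a].
  - by rewrite X'P ?xa // ?[b == a]eq_sym ?eX // def_e set22.
  - by rewrite xa.
  - by rewrite X'P ?xb // ?eX ?def_e ?set21 // adj_sym.
  - by rewrite xb setUC.
have edge_X' (e : {set T}) : e \subset X -> x \notin e -> e \subset X'.
  by move=> eX xe; rewrite subsetD1 eX xe.
exists (fun z => if z == x then u else p z),
       (fun e : {set T} => if x \in e then e0 else psi e).
split=> [z zX|z1 z2 z1X z2X|e1 e2|e eE eX|e z eE eX ze].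
- by case: eqVneq => // zx; apply/pU/X'P.
- case: eqVneq => [->|z1x]; case: eqVneq => [->//|z2x].
  + by rewrite (negPf (ub _ (X'P _ z2X z2x))).
  + move/(block_eq uD) => [_ eqB]; have p1X := X'P _ z1X z1x.
    have [_ p1D] := setDP (pU _ p1X).
    by have := ub _ p1X; rewrite eqB block_refl.
  + by apply: p_inj; apply: X'P.
- rewrite !inE => /andP[e1E e1X] /andP[e2E e2X].
  case: (boolP (x \in e1)) => xe1; case: (boolP (x \in e2)) => xe2.
  + have [a [aX' xa] ->] := edge_x _ e1E e1X xe1.
    have [b [bX' xb] ->] := edge_x _ e2E e2X xe2.
    by rewrite (xy a (subsetP sX' _ aX') xa) (xy b (subsetP sX' _ bX') xb).
  + have [a [aX' xa] _] := edge_x _ e1E e1X xe1.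
    by have [_ /(_ e2)/eqP + _ _] := e0P _ aX' xa => ne eqe; case: ne.
  + have [b [bX' xb] _] := edge_x _ e2E e2X xe2.
    by have [_ /(_ e1)/eqP + _ _] := e0P _ bX' xb => ne eqe; case: ne.
  + by apply: psi_inj; rewrite inE ?e1E ?e2E edge_X'.
- case: (boolP (x \in e)) => xe; last by apply: psiE => //; apply: edge_X'.
  by have [a [aX' xa] _] := edge_x _ eE eX xe; have [] := e0P _ aX' xa.
case: (boolP (x \in e)) => xe; last first.
  have zx : z != x by apply: contraNneq xe => <-.
  by rewrite (negPf zx); apply: p_psi => //; apply: edge_X'.
have [a [aX' xa] def_e] := edge_x _ eE eX xe; have [_ _ pa ue] := e0P _ aX' xa.
by move: ze; rewrite def_e !inE; case: eqVneq => //= _ /eqP->.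
Qed.

(** * Extensions of the skeleton *)

Lemma mem_hub_brace (T V : finType) (k : nat) (fr : frame T V k) (x : T)
    (e : {set T}) : (hub fr x \in brace fr e) = (x \in e).
Proof.
by rewrite inE (negPf (hub_gadget _ _ _)) orbF mem_imset //; apply: hub_inj.
Qed.

Lemma brace_junk (T V : finType) (k : nat) (fr : frame T V k) (e : {set T}) :
  brace fr e \subset junk fr.
Proof.
rewrite subUset gadget_junk andbT; apply/subsetP => _ /imsetP[x _ ->].
exact: hub_junk.
Qed.

(** In a larger [H], put [S] on the hubs and embed F - S greedily; braces, forest hyperedges and
    spokes then represent the edges inside [S], outside [S] and across. The three kinds are
    distinct: braces lie in the junk and the others do not, and a spoke contains one image of a
    vertex outside [S] while a forest hyperedge contains two. *)
Lemma card_skeleton_extension (T : finType) (adj : rel T) (V : finType)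
    (k : nat) (fr : frame T V k) (S : {set T}) (H : {set {set V}}) :
  symmetric adj -> irreflexive adj -> acyclic (delete_vertices adj S) ->
  skeleton adj fr S \subset H -> ~ contains_Berge adj H ->
  #|H| <= (2 ^ (#|junk fr| + #|T| * k.-1) + 2 ^ #|T|) * #|V|.+1.
Proof.
move=> adj_sym adj_irr acS /subsetP skH freeH; rewrite leqNgt; apply/negP.
set c := 2 ^ _ + _; rewrite mulnS addnC => H_gt; apply: freeH.
have D_le : 2 ^ #|junk fr| <= c.
  by apply: leq_trans (leq_addr _ _); rewrite leq_exp2l ?leq_addr.
have [E [/subsetP EH U0 deg]] := dense_core D_le H_gt.
have [p [psi [pD p_inj psi_inj psiE p_psi]]] :=
  forest_embedding adj_sym adj_irr acS U0 deg.
pose i x := if x \in S then hub fr x else p x.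
(* The last case is the spoke between the two ends of [e], written without choosing which end lies
   in [S]; see [phi_spoke]. *)
pose phi (e : {set T}) := if e \subset S then brace fr e else
  if [disjoint e & S] then psi e else
  hub fr @: (e :&: S) :|: \bigcup_(y in e :\: S) block fr (p y).
have phi_spoke s y : s \in S -> y \notin S ->
    phi [set s; y] = spoke fr s (p y).
  move=> sS yS; rewrite /phi.
  rewrite subUset !sub1set sS (negPf yS) /= disjoints_subset subUset !sub1set.
  rewrite inE sS /= /spoke; congr (_ :|: _).
    rewrite (_ : _ :&: _ = [set s]) ?imset_set1 //; apply/setP => x.
    rewrite !inE andb_orl; case: eqVneq => [->|_]; first by rewrite sS.
    by case: eqVneq => //= ->; rewrite (negPf yS).
  rewrite (_ : _ :\: _ = [set y]) ?big_set1 //; apply/setP => x.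
  rewrite !inE andb_orr orbC; case: eqVneq => [->|_]; first by rewrite yS.
  by case: eqVneq => [->|_]; rewrite ?sS // andbF.
have edge_cases e : e \in edges adj ->
  [\/ e \subset S /\ phi e = brace fr e,
      [disjoint e & S] /\ phi e = psi e
    | exists s y, [/\ s \in S, y \notin S & e = [set s; y]]].
  move=> eE; have [x [y [xy def_e]]] := edgesP eE.
  have [xS|xS] := boolP (x \in S); have [yS|yS] := boolP (y \in S).
  - have eS : e \subset S by rewrite def_e subUset !sub1set xS.
    by constructor 1; rewrite /phi eS.
  - by constructor 3; exists x, y.
  - by constructor 3; exists y, x; rewrite setUC.
  - have eS : [disjoint e & S].
      by rewrite def_e disjoints_subset subUset !sub1set !inE xS.
    by constructor 2; rewrite /phi eS def_e subUset !sub1set (negPf xS).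
have i_phi e x : e \in edges adj -> x \in e -> i x \in phi e.
  move=> eE xe; have [[eS ->]|[eS ->]|[s [y [sS yS def_e]]]] := edge_cases _ eE.
  - by rewrite /i (subsetP eS) // mem_hub_brace.
  - by rewrite /i (disjointFr eS) // p_psi.
  - rewrite def_e phi_spoke //; move: xe; rewrite def_e !inE /i.
    case/orP => /eqP->; first by rewrite sS eqxx.
    by rewrite (negPf yS) block_refl ?orbT // pD.
have spoke_block s x y : x \notin S -> y \notin S ->
    p x \in spoke fr s (p y) -> x = y.
  move=> xS yS; rewrite !inE => /orP[/eqP px|]; last exact: p_inj.
  by have := pD _ xS; rewrite px hub_junk.
have leave_junk e : e \in edges adj -> ~~ (e \subset S) ->
    ~~ (phi e \subset junk fr).
  move=> eE /subsetPn[x xe xS]; apply/subsetPn; exists (p x); last exact: pD.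
  by have := i_phi _ _ eE xe; rewrite /i (negPf xS).
have disjoint_spoke e s y : e \in edges adj -> [disjoint e & S] ->
    y \notin S -> phi e <> spoke fr s (p y).
  move=> eE eS yS def_h; have [a [b [ab def_e]]] := edgesP eE.
  have to_y x : x \in e -> x = y.
    move=> xe; have xS : x \notin S by rewrite (disjointFr eS).
    apply: (spoke_block s) => //.
    by rewrite -def_h; have := i_phi _ _ eE xe; rewrite /i (negPf xS).
  have [ae be] : a \in e /\ b \in e by rewrite def_e set21 set22.
  by move: ab; rewrite (to_y _ ae) (to_y _ be) adj_irr.
have edge_disjoint_sub e : e \in edges adj -> [disjoint e & S] ->
    ~~ (e \subset S).
  move=> /edgesP[a [b [_ ->]]] eS; apply/subsetPn; exists a; rewrite ?set21 //.
  by rewrite (disjointFr eS) ?set21.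
have pair_sub s y : y \notin S -> ~~ ([set s; y] \subset S).
  by move=> yS; apply/subsetPn; exists y; rewrite ?set22.
exists (phi @: edges adj).
  apply/subsetP => _ /imsetP[e eE ->].
  have [[eS ->]|[eS ->]|[s [y [sS yS ->]]]] := edge_cases _ eE.
  - by apply/skH/brace_skeleton.
  - by apply/EH/psiE.
  - by rewrite phi_spoke //; apply/skH/spoke_skeleton; rewrite ?pD.
exists V, i, id, phi; split=> //.
- move=> x y; rewrite /i; case: ifP => xS; case: ifP => yS.
  + exact: hub_inj.
  + by move=> hp; have := pD y; rewrite yS -hp hub_junk => /(_ isT).
  + by move=> hp; have := pD x; rewrite xS hp hub_junk => /(_ isT).
  + move=> pxy; apply: p_inj; rewrite ?xS ?yS //.
    by rewrite pxy block_refl // pD ?yS.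
- move=> e1 e2 E1 E2 eqphi.
  have subS : (e1 \subset S) = (e2 \subset S).
    have brace_sub (e : {set T}) : e \subset S -> phi e \subset junk fr.
      by move=> eS; rewrite /phi eS brace_junk.
    apply/idP/idP => eS; apply: contraT => /leave_junk.
      by rewrite -eqphi brace_sub // => /(_ E2).
    by rewrite eqphi brace_sub // => /(_ E1).
  have [[S1 h1]|[S1 h1]|[s1 [y1 [s1S y1S d1]]]] := edge_cases _ E1;
  have [[S2 h2]|[S2 h2]|[s2 [y2 [s2S y2S d2]]]] := edge_cases _ E2.
  + by apply/setP => x; rewrite -!(mem_hub_brace fr) -h1 -h2 eqphi.
  + by have := edge_disjoint_sub _ E2 S2; rewrite -subS S1.
  + by have := pair_sub s2 _ y2S; rewrite -d2 -subS S1.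
  + by have := edge_disjoint_sub _ E1 S1; rewrite subS S2.
  + by apply: psi_inj; rewrite ?inE ?E1 ?E2 // -h1 -h2.
  + by case: (disjoint_spoke e1 s2 y2) => //; rewrite eqphi d2 phi_spoke.
  + by have := pair_sub s1 _ y1S; rewrite -d1 subS S2.
  + by case: (disjoint_spoke e2 s1 y1) => //; rewrite -eqphi d1 phi_spoke.
  + move: eqphi; rewrite d1 d2 !phi_spoke // => eqh.
    have y12 : y1 = y2.
      by apply: (spoke_block s2) => //; rewrite -eqh setU1r ?block_refl ?pD.
    have := setU11 (hub fr s1) (block fr (p y1)); rewrite -/(spoke _ _ _) eqh.
    rewrite inE (negPf (block_junk (pD _ y2S) (hub_junk _ _))) orbF inE.
    by move/eqP/hub_inj => ->; rewrite y12.
- move=> e eE; apply/subsetP => _ /imsetP[x xe ->].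
  by rewrite imset_id i_phi.
Qed.

(** A largest Berge-F-free k-uniform hypergraph above [H0] is saturated: a further k-set that
    created no Berge-F would contradict maximality. *)
Lemma Berge_saturated_extension (T : finType) (adj : rel T) (V : finType)
    (k : nat) (H0 : {set {set V}}) :
  uniform k H0 -> ~ contains_Berge adj H0 ->
  exists2 H : {set {set V}}, H0 \subset H & Berge_saturated adj k H.
Proof.
move=> uH0 fH0.
pose P (H : {set {set V}}) := `[< [/\ H0 \subset H, uniform k H & ~ contains_Berge adj H] >].
have P0 : P H0 by apply/asboolP.
have [H /asboolP[sH uH fH] maxH] :=
  arg_maxnP (fun H : {set {set V}} => #|H|) P0.
exists H => //; split=> // h hk hH; apply: contrapT => fhH.
suff /maxH : P (h |: H) by rewrite /= cardsU1 hH add1n ltnn.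
apply/asboolP; split=> //; first by rewrite (subset_trans sH) ?subsetUr.
by move=> h'; rewrite in_setU1 => /predU1P[->|/uH].
Qed.

(** * Frames built from intervals of integers *)

Definition ord_interval (n m b : nat) : {set 'I_n} :=
  [set v : 'I_n | v %/ m == b].

Lemma card_ord_interval_le (n m b : nat) : 0 < m -> #|ord_interval n m b| <= m.
Proof.
move=> m_gt0; rewrite -[leqRHS]card_ord.
pose r (v : 'I_n) := Ordinal (ltn_pmod v m_gt0).
rewrite -(card_in_imset (f := r)) ?max_card // => u v.
rewrite !inE => /eqP ub /eqP vb /(congr1 val) /= eq_r.
by apply: val_inj; rewrite /= (divn_eq u m) (divn_eq v m) ub vb eq_r.
Qed.

Lemma card_ord_interval (n m b : nat) :
  0 < m -> b.+1 * m <= n -> #|ord_interval n m b| = m.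
Proof.
move=> m_gt0 bn; apply/eqP; rewrite eqn_leq card_ord_interval_le //=.
have lt_n (r : 'I_m) : b * m + r < n.
  by apply: leq_trans bn; rewrite mulSn addnC ltn_add2r.
pose pt r := Ordinal (lt_n r).
rewrite -[leqLHS]card_ord -(card_imset (f := pt)); last first.
  by move=> r s /(congr1 val)/addnI/val_inj.
apply/subset_leq_card/subsetP => _ /imsetP[r _ ->].
by rewrite inE /= divnMDl // divn_small ?addn0.
Qed.

(* The first #|T| + #|{set T}| intervals of length k.-1 carry the hubs and the *)
(* gadgets, each gadget leaving out the left end of its interval; the other    *)
(* complete intervals are the blocks.                                          *)
Lemma interval_frame (T : finType) (k n : nat) :
  2 < k -> (#|T| + 2 ^ #|T|) * k.-1 <= n ->
  exists fr : frame T 'I_n k, #|junk fr| <= (#|T| + 2 ^ #|T|).+1 * k.-1.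
Proof.
move=> k_gt2; set m := k.-1; set N := #|T| + _ => n_ge.
have m_gt0 : 0 < m by rewrite /m -subn1 subn_gt0 ltnW.
have card_setT : #|{set T}| = 2 ^ #|T|.
  by have := card_powerset [set: T]; rewrite powersetT !cardsT.
pose sidx (x : T) : nat := enum_rank x.
pose gidx (e : {set T}) := #|T| + enum_rank e.
have sidx_lt x : sidx x < N.
  by rewrite (leq_trans (ltn_ord (enum_rank x))) ?leq_addr.
have gidx_lt e : gidx e < N.
  by rewrite /gidx ltn_add2l -card_setT.
have sgidx x e : sidx x != gidx e.
  by rewrite neq_ltn (leq_trans (ltn_ord (enum_rank x))) ?leq_addr.
have sidx_inj : injective sidx by move=> x y /val_inj/enum_rank_inj.
have gidx_inj : injective gidx by move=> x y /addnI/val_inj/enum_rank_inj.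
have start_lt b : b < N -> b * m < n.
  by move=> bN; apply: leq_trans n_ge; rewrite ltn_pmul2r.
pose start b (bN : b < N) : 'I_n := Ordinal (start_lt b bN).
(* The incomplete interval at the end, possibly empty, is junk too, so that every block has exactly
   [k.-1] vertices. *)
pose D : {set 'I_n} := [set v : 'I_n | (v %/ m < N) || (n %/ m <= v %/ m)].
have inD b (v : 'I_n) : b < N -> v \in ord_interval n m b -> v \in D.
  by move=> bN; rewrite !inE => /eqP ->; rewrite bN.
have startP b (bN : b < N) : start b bN \in ord_interval n m b.
  by rewrite inE /= mulnK.
pose hb x := start _ (sidx_lt x).
pose gd e := ord_interval n m (gidx e) :\ start _ (gidx_lt e).
have gd_sub e : gd e \subset ord_interval n m (gidx e) by apply: subsetDl.
pose bl (v : 'I_n) := ord_interval n m (v %/ m).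
have hb_inj : injective hb.
  move=> x y xy; apply: sidx_inj; have := startP _ (sidx_lt x).
  by rewrite -/(hb x) xy inE /= mulnK // => /eqP.
have hbD x : hb x \in D by apply: inD (startP _ _).
have gdD e : gd e \subset D.
  by apply: subset_trans (gd_sub e) _; apply/subsetP => v; apply: inD.
have hb_gd x e : hb x \notin gd e.
  apply/negP => /(subsetP (gd_sub e)); rewrite inE /= mulnK //.
  by rewrite (negPf (sgidx x e)).
have gd_inj e1 e2 v : v \in gd e1 -> v \in gd e2 -> e1 = e2.
  move=> /(subsetP (gd_sub e1)) + /(subsetP (gd_sub e2)).
  by rewrite !inE => /eqP-> /eqP/gidx_inj.
have card_gd e : #|gd e| = k.-2.
  have := cardsD1 (start _ (gidx_lt e)) (ord_interval n m (gidx e)).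
  rewrite startP card_ord_interval //.
    by rewrite -/(gd e) add1n -[k.-2]/(m.-1) => ->.
  by apply: leq_trans n_ge; rewrite leq_pmul2r.
have bl_refl v : v \notin D -> v \in bl v by rewrite [v \in bl v]inE.
have bl_eq u v : v \notin D -> u \in bl v -> u \notin D /\ bl u = bl v.
  rewrite [u \in bl v]inE => + /eqP uv; rewrite /bl uv => vD; split=> //.
  by move: vD; rewrite !inE uv.
have card_bl v : v \notin D -> #|bl v| = m.
  rewrite inE negb_or -!ltnNge => /andP[_ vn]; apply: card_ord_interval => //.
  by apply: leq_trans (leq_trunc_div n m); rewrite leq_mul2r vn orbT.
exists (Frame hb_inj hbD gdD hb_gd gd_inj card_gd bl_refl bl_eq card_bl) => /=.
(* The index [b = N] stands for the incomplete interval, so [N.+1] intervals cover the junk. *)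
apply: leq_trans (_ : \sum_(b < N.+1)
  #|ord_interval n m (if b < N then b : nat else n %/ m)| <= _); last first.
  apply: leq_trans (_ : \sum_(b < N.+1) m <= _).
    by apply: leq_sum => b _; apply: card_ord_interval_le.
  by rewrite sum_nat_const card_ord.
have sub_D : D \subset \bigcup_(b < N.+1)
    ord_interval n m (if b < N then b : nat else n %/ m).
  apply/subsetP => v; rewrite inE; case: ltnP => [vN _|_ /= nv].
    apply/bigcupP; exists (Ordinal (ltnW vN : v %/ m < N.+1)) => //=.
    by rewrite vN inE.
  apply/bigcupP; exists ord_max => //=; rewrite ltnn inE eqn_leq nv andbT.
  by rewrite leq_div2r // ltnW.
apply: leq_trans (subset_leq_card sub_D) _.
elim/big_rec2: _ => [|b s B _ IH]; first by rewrite cards0.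
by apply: leq_trans (leq_card_setU _ _) _; rewrite leq_add2l.
Qed.

(** * The linear bound *)

Lemma lt_girthP (T : finType) (adj : rel T) (f : nat) :
  lt_girth f (girth adj) -> forall m, has_cycle adj m -> f < m.
Proof.
case def_g: (girth adj) => [g|] /=; last first.
  by move/girth_NoneP: def_g => ac _ m; rewrite (negPf (ac m)).
by have [_ min_g] := (girth_SomeP _ _).1 def_g => fg m /min_g; apply: leq_trans.
Qed.

Lemma sat_linear (T : finType) (adj : rel T) (k : nat) :
  symmetric adj -> irreflexive adj -> (exists x y, adj x y) ->
  no_isolated adj -> 2 < k -> lt_girth (feedback_number adj) (girth adj) ->
  exists c N, forall n, N <= n -> sat adj k n <= c * n.+1.
Proof.
move=> adj_sym adj_irr adj_edge iso k_gt2 /lt_girthP long.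
have [[S acS card_S] minS] := feedback_numberP adj.
(* The bound on the junk from [interval_frame], independent of [n]. *)
pose d := (#|T| + 2 ^ #|T|).+1 * k.-1.
exists (2 ^ (d + #|T| * k.-1) + 2 ^ #|T|), ((#|T| + 2 ^ #|T|) * k.-1) => n n_ge.
have [fr junk_le] := interval_frame k_gt2 n_ge.
have sk_free : ~ contains_Berge adj (skeleton adj fr S).
  apply: skeleton_free => // [R|m]; rewrite card_S; last exact: long.
  by rewrite ltnNge => /negP RS /minS.
have [H skH satH] :=
  Berge_saturated_extension (uniform_skeleton adj_irr (ltnW k_gt2)) sk_free.
have [_ freeH _] := satH.
apply: leq_trans ((satP k n adj_edge).2 _ satH) _.
apply: leq_trans (card_skeleton_extension adj_sym adj_irr acS skH freeH) _.
by rewrite card_ord leq_mul2r leq_add2r leq_exp2l // leq_add2r junk_le orbT.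
Qed.

From mathcomp Require Import all_order all_algebra.
From mathcomp Require Import all_classical all_reals all_analysis.
Import numFieldNormedType.Exports.
Local Open Scope classical_set_scope.
Local Open Scope ring_scope.

Theorem theorem1p4 (R : realType) (T : finType) (adj : rel T)
    (adj_sym : symmetric adj) (adj_irr : irreflexive adj)
    (adj_edge : exists x y, adj x y) (adj_iso : no_isolated adj)
    (k : nat) (k_ge3 : (3 <= k)%N)
    (girth_gt : lt_girth (feedback_number adj) (girth adj)) :
  (fun n : nat => (sat adj k n)%:R : R) =O_\oo (fun n : nat => n%:R : R).
Proof.
have [c [N le_c]] :=
  sat_linear adj_sym adj_irr adj_edge adj_iso k_ge3 girth_gt.
(* The factor 2 comes from [n.+1 <= 2 * n] for positive [n]; the successor makes the constant
   positive. *)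
apply/eqO_exP; exists ((c * 2).+1%:R); first by rewrite Num.Theory.ltr0Sn.
exists N.+1 => // n /= Nn; rewrite !Num.Theory.normr_nat -GRing.natrM.
rewrite Num.Theory.ler_nat.
have n_gt0 : (0 < n)%N by apply: leq_trans Nn.
apply: leq_trans (le_c n (ltnW Nn)) _; apply: (@leq_trans (c * 2 * n)%N).
  by rewrite -mulnA leq_mul2l mul2n -addnn -addn1 leq_add2l n_gt0 orbT.
by rewrite leq_mul2r leqnSn orbT.
Qed.
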